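(* Let $A\in M_n(\mathbb{Z})$ be invertible such that $x\mapsto A^{-1}x$ is a similarity with respect to Euclidean distance, and let $D$ be a subset of a complete residue system mod $A$. Then the set of $\alpha\in T_{A,D-D}$ for which the box-counting dimension of $T_{A,D}\cap(T_{A,D}+\alpha)$ exists and equals $\dim_B T_{A,D}$ is dense in $T_{A,D-D}$.
   Context: A similarity means a map $f$ with $\|f(x)-f(y)\|=c\|x-y\|$ for some $c\in(0,1)$ and all $x,y$. For finite $E\subset\mathbb{R}^n$, $\pi_{A,E}((e_j)_{j\ge1})=\sum_{j\ge1}A^{-j}e_j$ for $(e_j)\in E^{\mathbb{N}}$ and $T_{A,E}=\pi_{A,E}(E^{\mathbb{N}})$. $D-D=\{a-b:a,b\in D\}$. A complete residue system mod $A$ is a set $\mathcal{D}\subset\mathbb{Z}^n$ mapping bijectively onto $\mathbb{Z}^n/A\mathbb{Z}^n$. *)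

(* Defs.v *)
From HB Require Import structures.
From mathcomp Require Import all_boot all_order all_algebra.
From mathcomp Require Import all_classical all_reals all_analysis.
Set Implicit Arguments. Unset Strict Implicit. Unset Printing Implicit Defensive.
Import Order.TTheory GRing.Theory Num.Theory.
Import numFieldNormedType.Exports.
Local Open Scope classical_set_scope.
Local Open Scope ring_scope.

Section Defs.
Variable R : realType.
Variable n : nat.

Definition enorm (v : 'cV[R]_n) : R := Num.sqrt (\sum_(i < n) (v i 0) ^+ 2).

Definition intmxR (A : 'M[int]_n) : 'M[R]_n := map_mx (fun z : int => z%:~R) A.
Definition intvR (v : 'cV[int]_n) : 'cV[R]_n := map_mx (fun z : int => z%:~R) v.

Definition inv_is_similarity (A : 'M[int]_n) : Prop :=
  exists c : R, 0 < c < 1 /\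
    forall x y : 'cV[R]_n,
      enorm (invmx (intmxR A) *m x - invmx (intmxR A) *m y) = c * enorm (x - y).

Definition latticeA (A : 'M[int]_n) : set 'cV[int]_n :=
  [set A *m z | z in [set: 'cV[int]_n]].

Definition complete_residue_system (A : 'M[int]_n) (Dc : set 'cV[int]_n) : Prop :=
  forall z : 'cV[int]_n,
    exists! d : 'cV[int]_n, Dc d /\ latticeA A (z - d).

Definition diffset (D : set 'cV[int]_n) : set 'cV[int]_n :=
  [set a - b | a in D & b in D].

Definition TAE (A : 'M[int]_n) (E : set 'cV[int]_n) : set 'cV[R]_n :=
  [set x | exists e : nat -> 'cV[int]_n, (forall j, E (e j)) /\
     (fun N : nat => \sum_(j < N) (invmx (intmxR A) ^+ j.+1 *m intvR (e j)))
       @ \oo --> x].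

Definition translate (F : set 'cV[R]_n) (a : 'cV[R]_n) : set 'cV[R]_n :=
  [set x + a | x in F].

Definition diam_le (U : set 'cV[R]_n) (delta : R) : Prop :=
  forall x y, U x -> U y -> enorm (x - y) <= delta.

Definition coverable (F : set 'cV[R]_n) (delta : R) (k : nat) : Prop :=
  exists U : nat -> set 'cV[R]_n,
    (forall i, (i < k)%N -> diam_le (U i) delta) /\
    (forall x, F x -> exists2 i, (i < k)%N & U i x).

Definition covering_number (F : set 'cV[R]_n) (delta : R) : R :=
  inf [set (k%:R : R) | k in [set k : nat | coverable F delta k]].

Definition has_box_dim (F : set 'cV[R]_n) (d : R) : Prop :=
  F !=set0 /\ (exists M : R, forall x, F x -> enorm x <= M) /\
  (fun delta : R => ln (covering_number F delta) / (- ln delta))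
     @ 0^'+ --> d.

Definition dense_in (X S : set 'cV[R]_n) : Prop :=
  X `<=` S /\
  forall a, S a -> forall eps : R, 0 < eps -> exists2 b, X b & enorm (b - a) < eps.

End Defs.

(* Main.v *)
Require Import Defs.
From HB Require Import structures.
From mathcomp Require Import all_boot all_order all_algebra.
From mathcomp Require Import all_classical all_reals all_analysis.
From mathcomp Require Import finmap ring lra.
Import Order.TTheory GRing.Theory Num.Theory.
Import numFieldNormedType.Exports.
Local Open Scope classical_set_scope.
Local Open Scope ring_scope.

(* Write [B = A^-1], [T = TAE A D] and [N = #|D|]. Distinct words of [k] digits
   have partial sums [sum_(j < k) B^(j+1) e_j = B^k z] with distinct integer
   vectors [z], hence at distance at least [c^k], while [T] is covered by the
   [N^k] cylinders [sum_(j < k) B^(j+1) e_j + B^k T]. So every subset of [T]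
   containing a cylinder has box dimension [ln N / - ln c]. If the expansion
   [e_j = p_j - q_j] of [a] is cut after [m] digits, the resulting [alpha] is
   close to [a], and [T `&` (T + alpha)] contains the cylinder of the word
   [p_0 ... p_(m-1)]. *)

Set Implicit Arguments.
Unset Strict Implicit.

(** * The Euclidean norm on column vectors *)

Section EuclideanNorm.
Variables (R : realType) (n : nat).
Implicit Types v w : 'cV[R]_n.

(** Equivalent to [enorm] up to the factor [n], with an entrywise triangle inequality; sums of
    vectors are estimated in it. *)
Definition l1norm v : R := \sum_(i < n) `|v i 0|.

Lemma enorm_ge0 v : 0 <= enorm v.
Proof. exact: sqrtr_ge0. Qed.

Lemma le_entry_enorm v i : `|v i 0| <= enorm v.
Proof.
rewrite /enorm -sqrtr_sqr ler_wsqrtr // (bigD1 i) //= lerDl.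
by apply: sumr_ge0 => j _; exact: sqr_ge0.
Qed.

(** Each square [|v_i|^2] is at most [|v_i|] times the whole sum of absolute values. *)
Lemma enorm_le_l1norm v : enorm v <= l1norm v.
Proof.
have l0 : 0 <= l1norm v by apply: sumr_ge0.
rewrite -[leRHS]ger0_norm // -sqrtr_sqr ler_wsqrtr // expr2 {1}/l1norm mulr_suml.
apply: ler_sum => i _; rewrite -[leLHS]ger0_norm ?sqr_ge0 // normrX expr2.
rewrite ler_wpM2l // /l1norm (bigD1 i) //= lerDl.
exact: sumr_ge0.
Qed.

Lemma l1norm_le_enorm v : l1norm v <= n%:R * enorm v.
Proof.
rewrite -[n in n%:R]card_ord mulr_natl -sumr_const.
by apply: ler_sum => i _; exact: le_entry_enorm.
Qed.

Lemma ler_l1normD v w : l1norm (v + w) <= l1norm v + l1norm w.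
Proof.
by rewrite -big_split; apply: ler_sum => i _; rewrite mxE; exact: ler_normD.
Qed.

Lemma l1normN v : l1norm (- v) = l1norm v.
Proof. by apply: eq_bigr => i _; rewrite mxE normrN. Qed.

Lemma l1norm0 : l1norm 0 = 0.
Proof. by rewrite /l1norm big1 // => i _; rewrite mxE normr0. Qed.

Lemma ler_l1norm_sum (I : Type) (r : seq I) (F : I -> 'cV[R]_n) :
  l1norm (\sum_(j <- r) F j) <= \sum_(j <- r) l1norm (F j).
Proof.
elim: r => [|j r IH]; first by rewrite !big_nil l1norm0.
by rewrite !big_cons (le_trans (ler_l1normD _ _)) // lerD2l.
Qed.

Lemma enorm0 : enorm (0 : 'cV[R]_n) = 0.
Proof.
by apply/le_anti; rewrite enorm_ge0 andbT -l1norm0 enorm_le_l1norm.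
Qed.

Lemma enorm_eq0 v : enorm v = 0 -> v = 0.
Proof.
move=> v0; apply/matrixP => i j; rewrite ord1 mxE; apply/normr0_eq0/le_anti.
by rewrite normr_ge0 andbT -v0 le_entry_enorm.
Qed.

Lemma enormBC v w : enorm (v - w) = enorm (w - v).
Proof.
by rewrite /enorm; congr Num.sqrt; apply: eq_bigr => i _;
  rewrite -opprB mxE sqrrN.
Qed.

(** The topology on matrices is entrywise; this passes to Euclidean distances, which [B] scales
    exactly. *)
Lemma cvg_enormP (u : nat -> 'cV[R]_n) v :
  u @ \oo --> v <-> enorm (v - u k) @[k --> \oo] --> 0.
Proof.
split=> [/cvg_ballP uv | uv].
- apply/cvgrPdist_le => e e0.
  (* The divisor [n + 1] stays nonzero for [n = 0], and [n] entries below [e / (n + 1)] sum to at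
     most [e]. *)
  have e'0 : 0 < e / n.+1%:R by rewrite divr_gt0.
  near=> k.
  rewrite sub0r normrN ger0_norm ?enorm_ge0 //.
  have [_ kv] : ball v (e / n.+1%:R) (u k) by near: k; exact: uv.
  rewrite (le_trans (enorm_le_l1norm _)) // (@le_trans _ _ (\sum_(i < n) e / n.+1%:R)) //.
    by apply: ler_sum => i _; rewrite mxE mxE; apply: ltW; exact: (kv i 0).
  rewrite sumr_const card_ord -[_ *+ n]mulr_natr -mulrA ger_pMr //.
  by rewrite mulrC ler_pdivrMr // mul1r ler_nat.
- apply/cvg_ballP => e e0; near=> k; split=> // i j; rewrite ord1.
  have := le_entry_enorm (v - u k) i; rewrite mxE mxE => /le_lt_trans; apply.
  rewrite -[ltLHS]ger0_norm ?enorm_ge0 // -normrN -sub0r.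
  by near: k; move/cvgrPdist_lt: uv; exact.
Unshelve. all: by end_near. Qed.

Lemma enorm_intvR_ge1 (z : 'cV[int]_n) : z != 0 -> 1 <= enorm (intvR R z).
Proof.
move=> z0; have [i zi] : exists i, z i 0 != 0.
  apply/existsP; apply: contraNT z0; rewrite negb_exists => /forallP zi.
  apply/eqP/matrixP => i j; rewrite ord1 mxE; apply/eqP.
  by have := zi i; rewrite negbK.
apply: le_trans (le_entry_enorm _ i); rewrite mxE -intr_norm.
by rewrite (_ : 1 = 1%:~R) // ler_int -gtz0_ge1 normr_gt0.
Qed.

End EuclideanNorm.

(** * Digit expansions: concatenation, splitting, boundedness *)

Section DigitExpansions.
Variables (R : realType) (n : nat) (A : 'M[int]_n) (c : R).
Hypothesis A_unit : intmxR R A \in unitmx.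
Hypothesis c01 : 0 < c < 1.
Let B : 'M[R]_n := invmx (intmxR R A).
Hypothesis enormB : forall x : 'cV[R]_n, enorm (B *m x) = c * enorm x.
Implicit Types (e : nat -> 'cV[int]_n) (E : set 'cV[int]_n).

Let c_gt0 : 0 < c. Proof. by case/andP: c01. Qed.
Let c_ge0 : 0 <= c. Proof. exact: ltW. Qed.

Definition digit_sum e k : 'cV[R]_n :=
  \sum_(j < k) (invmx (intmxR R A) ^+ j.+1 *m intvR R (e j)).

Definition digit_cat e k e' j := if (j < k)%N then e j else e' (j - k)%N.

Lemma digit_sum0 e : digit_sum e 0 = 0.
Proof. by rewrite /digit_sum big_ord0. Qed.

Lemma digit_sumS e k :
  digit_sum e k.+1 = digit_sum e k + B ^+ k.+1 *m intvR R (e k).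
Proof. by rewrite /digit_sum big_ord_recr. Qed.

Lemma digit_sum_cat e k e' q :
  digit_sum (digit_cat e k e') (k + q) =
  digit_sum e k + B ^+ k *m digit_sum e' q.
Proof.
elim: q => [|q IH].
  rewrite addn0 (digit_sum0 e') mulmx0 addr0.
  by apply: eq_bigr => j _; rewrite /digit_cat ltn_ord.
rewrite addnS !digit_sumS IH -addrA mulmxDr; congr (_ + (_ + _)).
by rewrite /digit_cat ltnNge leq_addr /= addKn mulmxA -addnS exprD.
Qed.

Lemma digit_sumD e k q : digit_sum e (k + q) =
  digit_sum e k + B ^+ k *m digit_sum (fun j => e (k + j)%N) q.
Proof.
rewrite -digit_sum_cat; congr digit_sum; apply/funext => j.
by rewrite /digit_cat; case: ltnP => // /subnKC ->.
Qed.

Lemma enorm_expB k v : enorm (B ^+ k *m v) = c ^+ k * enorm v.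
Proof.
elim: k => [|k IH]; first by rewrite !expr0 mul1mx mul1r.
by rewrite exprS -mulmxA enormB IH exprS mulrA.
Qed.

(** Once the index is shifted by [k], the error of the concatenated expansion is [c^k] times that of
    [t]. *)
Lemma TAE_cat {E e k t} : (forall j, E (e j)) -> TAE A E t ->
  TAE A E (digit_sum e k + B ^+ k *m t).
Proof.
move=> Ee [e' [Ee' /cvg_enormP ct]]; exists (digit_cat e k e'); split.
  by move=> j; rewrite /digit_cat; case: ifP.
apply/cvg_enormP; rewrite -(cvg_shiftn k).
rewrite (_ : [sequence _]_q =
    (fun q => c ^+ k * enorm (t - digit_sum e' q))); last first.
  apply/funext => q /=; rewrite -/(digit_sum _ _) addnC digit_sum_cat.
  by rewrite opprD addrACA subrr add0r -mulmxBr enorm_expB.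
by have := cvgM (cvg_cst (c ^+ k)) ct; rewrite mulr0; exact.
Qed.

Lemma TAE_split {E x} k : TAE A E x ->
  exists e t, [/\ forall j, E (e j), TAE A E t &
    x = digit_sum e k + B ^+ k *m t].
Proof.
move=> [e [Ee /cvg_enormP cx]].
(* The tail is what remains after undoing [B^k]; its errors are those of [x] divided by [c^k]. *)
pose t := intmxR R A ^+ k *m (x - digit_sum e k).
have Bt : B ^+ k *m t = x - digit_sum e k.
  rewrite mulmxA; suff -> : B ^+ k *m intmxR R A ^+ k = 1%:M by rewrite mul1mx.
  elim: k {t} => [|k IH]; first by rewrite !expr0 mul1mx.
  rewrite exprSr exprS -[_ * B]/(_ *m B) -[_ * _ ^+ k]/(_ *m _ ^+ k).
  by rewrite -mulmxA (mulmxA B) mulVmx // mul1mx.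
exists e, t; split=> //; last by rewrite Bt addrC subrK.
exists (fun j => e (k + j)%N); split=> //; apply/cvg_enormP.
rewrite (_ : (fun q => _) =
    (fun q => (c ^+ k)^-1 * enorm (x - digit_sum e (q + k)))); last first.
  apply/funext => q; apply: (mulfI (lt0r_neq0 (exprn_gt0 k c_gt0))).
  rewrite mulrA mulfV ?(lt0r_neq0 (exprn_gt0 _ _)) // mul1r -enorm_expB.
  by rewrite mulmxBr Bt addnC digit_sumD opprD addrA.
move: cx; rewrite -(cvg_shiftn k) => /(cvgM (cvg_cst (c ^+ k)^-1)).
by rewrite mulr0; exact.
Qed.

(* The fixed point of [x |-> B (x + d)] is the point with constant digits [d]. *)
Lemma TAE_nonempty {E d} : E d -> @TAE R n A E !=set0.
Proof.
(* A vector fixed by [B] has norm equal to [c] times itself, hence is zero; the transposes turn the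
   row kernel into a column one. *)
move=> Ed; have uB : 1%:M - B \in unitmx.
  rewrite -unitmx_tr -row_free_unit; apply: inj_row_free => v /(congr1 trmx).
  rewrite trmx_mul trmxK mulmxBl mul1mx trmx0 => /eqP; rewrite subr_eq0 => /eqP vB.
  apply: trmx_inj; rewrite trmx0; apply: enorm_eq0; apply/eqP.
  have /eqP := enormB v^T; rewrite -vB -subr_eq0 -{1}[enorm _]mul1r -mulrBl.
  by rewrite mulf_eq0 subr_eq0 eq_sym lt_eqF //; case/andP: c01.
pose t := invmx (1%:M - B) *m (B *m intvR R d).
have tE : t = B *m intvR R d + B *m t.
  apply/eqP; rewrite -subr_eq -{1}[t]mul1mx -mulmxBl mulmxA mulmxV //.
  by rewrite mul1mx.
exists t, (fun=> d); split=> //; apply/cvg_enormP.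
rewrite (_ : (fun q => _) = (fun q => c ^+ q * enorm t)); last first.
  apply/funext => q; rewrite -enorm_expB; congr enorm.
  apply/eqP; rewrite subr_eq addrC; apply/eqP.
  elim: q => [|q IH]; first by rewrite big_ord0 expr0 mul1mx add0r.
  rewrite {1}IH big_ord_recr /= -addrA; congr (_ + _).
  by rewrite {1}tE mulmxDr !mulmxA !exprSr.
have /cvg_expr cc : `|c| < 1 by rewrite ger0_norm //; case/andP: c01.
by have := cvgM cc (cvg_cst (enorm t)); rewrite mul0r; exact.
Qed.

Lemma TAE_0 {E} : E 0 -> TAE A E (0 : 'cV[R]_n).
Proof.
move=> E0; exists (fun=> 0); split=> //; apply/cvg_enormP.
rewrite (_ : (fun q => _) = fun=> 0); first exact: cvg_cst.
apply/funext => q; rewrite big1 ?subrr ?enorm0 // => j _.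
by rewrite /intvR map_mx0 mulmx0.
Qed.

Lemma TAE_bounded {E} {M : R} : (forall d, E d -> enorm (intvR R d) <= M) ->
  exists L, forall x : 'cV[R]_n, TAE A E x -> l1norm x <= L.
Proof.
move=> EM; exists (n%:R * M * (1 - c)^-1 + n%:R) => x [e [Ee /cvg_enormP cx]].
have c1 : 0 < 1 - c by rewrite subr_gt0; case/andP: c01.
have sumle q : l1norm (digit_sum e q) <= n%:R * M * (1 - c)^-1.
  have M0 : 0 <= M by apply: le_trans (enorm_ge0 _) (EM _ (Ee 0%N)).
  apply: (@le_trans _ _ (\sum_(j < q) (n%:R * M * c ^+ j))).
    rewrite (le_trans (ler_l1norm_sum _ _)) //; apply: ler_sum => j _.
    rewrite (le_trans (l1norm_le_enorm _)) // -mulrA ler_wpM2l ?ler0n //.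
    rewrite enorm_expB mulrC ler_pM ?enorm_ge0 ?exprn_ge0 ?EM //.
    by rewrite exprS ler_piMl ?exprn_ge0 // ltW //; case/andP: c01.
  rewrite -mulr_sumr ler_wpM2l ?mulr_ge0 ?ler0n //.
  rewrite -[leRHS]mul1r ler_pdivlMr // mulrC.
  rewrite -[1 - c]opprB mulNr -subrX1 opprB.
  by rewrite gerBl exprn_ge0.
have /cvgrPdist_le/(_ 1 ltr01) [q _ /(_ q (leqnn q))] := cx.
rewrite /= sub0r normrN ger0_norm ?enorm_ge0 // => xq.
rewrite -[x in l1norm x](subrK (digit_sum e q)) (le_trans (ler_l1normD _ _)) //.
rewrite addrC lerD // (le_trans (l1norm_le_enorm _)) //.
by rewrite ler_piMr.
Qed.

(** * Integer vectors of words and their separation *)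

Fixpoint horner_digits e k : 'cV[int]_n :=
  if k is k'.+1 then A *m horner_digits e k' + e k' else 0.

(** [horner_digits e k] is [A^(k-1) e_0 + ... + e_(k-1)], the partial sum cleared of denominators by
    [A^k]. *)
Lemma digit_sum_horner e k :
  digit_sum e k = B ^+ k *m intvR R (horner_digits e k).
Proof.
elim: k => [|k IH]; first by rewrite digit_sum0 /intvR map_mx0 mulmx0.
rewrite digit_sumS IH /= /intvR map_mxD map_mxM mulmxDr; congr (_ + _).
by rewrite mulmxA exprSr -[_ * B]/(_ *m B) mulmxKV.
Qed.

Lemma det_neq0 : \det A != 0.
Proof.
have := A_unit; rewrite unitmxE /intmxR.
have -> : \det (map_mx (fun z => z%:~R) A) = (\det A)%:~R :> R.
  exact: (det_map_mx (intmul (1 : R))).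
by rewrite unitfE intr_eq0.
Qed.

(** Over the integers the adjugate replaces the inverse, leaving the nonzero factor [\det A] to
    cancel. *)
Lemma mulmxA_inj (x y : 'cV[int]_n) : A *m x = A *m y -> x = y.
Proof.
move=> /(congr1 (mulmx (\adj A))); rewrite !mulmxA mul_adj_mx !mul_scalar_mx.
move=> /matrixP xy; apply/matrixP => i j; have := xy i j; rewrite !mxE.
exact/mulfI/det_neq0.
Qed.

Variable Dc : set 'cV[int]_n.
Hypothesis Dc_residues : complete_residue_system A Dc.

Lemma residue_inj (x y : 'cV[int]_n) : Dc x -> Dc y -> latticeA A (x - y) -> x = y.
Proof.
move=> Dx Dy xy; have [d [_ dP]] := Dc_residues x.
have <- : d = x by apply: dP; split=> //; exists 0; rewrite // subrr mulmx0.
exact: dP.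
Qed.

(** Modulo [A] only the last digit survives, so the two last digits agree; cancel them and [A], then
    descend. *)
Lemma horner_digits_inj e e' k : (forall j, Dc (e j)) -> (forall j, Dc (e' j)) ->
  horner_digits e k = horner_digits e' k -> forall j, (j < k)%N -> e j = e' j.
Proof.
move=> De De'; elim: k => // k IH /= ee' j.
have ek : e k = e' k.
  apply: residue_inj => //; exists (horner_digits e' k - horner_digits e k) => //.
  have Ah' : A *m horner_digits e' k = A *m horner_digits e k + e k - e' k.
    by rewrite ee' addrK.
  by rewrite mulmxBr Ah' addrAC [_ + e k]addrC addrK.
move: ee'; rewrite ek => /addIr /mulmxA_inj /IH {}IH.
by rewrite ltnS leq_eqVlt => /orP[/eqP->//|]; exact: IH.
Qed.

Lemma enorm_digit_sum_sep {e e' k} :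
  (forall j, Dc (e j)) -> (forall j, Dc (e' j)) ->
  (exists2 j, (j < k)%N & e j <> e' j) ->
  c ^+ k <= enorm (digit_sum e k - digit_sum e' k).
Proof.
move=> De De' [j jk ejj]; rewrite !digit_sum_horner -mulmxBr enorm_expB.
rewrite ler_peMr ?exprn_ge0 //.
have -> : intvR R (horner_digits e k) - intvR R (horner_digits e' k) =
          intvR R (horner_digits e k - horner_digits e' k).
  by rewrite /intvR map_mxB.
apply: enorm_intvR_ge1; rewrite subr_eq0; apply/eqP => /horner_digits_inj.
by move=> /(_ De De' j jk).
Qed.

(* [det A * z = A (adj A z)], so residues mod [det A] separate the digits. *)
Lemma residue_system_finite : finite_set Dc.
Proof.
have [m mE] : exists m, `|\det A|%N = m.+1.
  by exists (`|\det A|.-1)%N; rewrite prednK // absz_gt0 det_neq0.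
pose f (z : 'cV[int]_n) : {ffun 'I_n -> 'I_m.+1} :=
  [ffun i => inord `|modz (z i 0%R) (\det A)|%N].
suff fI : {in Dc &, injective f}.
  have := inj_card_eq fI; rewrite card_eq_sym => /card_eqPle [+ _].
  by move/card_le_finite; apply; exact: finite_finset.
move=> x y /set_mem Dx /set_mem Dy fxy; apply: residue_inj => //.
exists (\adj A *m (\col_i divz ((x - y) i 0) (\det A))) => //.
rewrite mulmxA mul_mx_adj mul_scalar_mx; apply/matrixP => i j.
rewrite ord1 !mxE mulrC; apply: divzK.
have modlt (z : 'cV[int]_n) : (`|modz (z i 0%R) (\det A)| < m.+1)%N.
  by rewrite -mE -ltz_nat gez0_abs ?modz_ge0 ?ltz_mod ?det_neq0.
rewrite -eqz_mod_dvd; apply/eqP.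
have /ffunP/(_ i) := fxy; rewrite !ffunE => /(congr1 val).
rewrite /= !inordK // => xy.
by rewrite -[LHS]gez0_abs ?modz_ge0 ?det_neq0 // xy gez0_abs ?modz_ge0 ?det_neq0.
Qed.

End DigitExpansions.

(** * Bounds on covering numbers *)

Section Coverings.
Variables (R : realType) (n : nat).
Implicit Types (F : set 'cV[R]_n) (delta : R).

Lemma coverable_card F delta (W : finType) (U : W -> set 'cV[R]_n) :
  (forall w, diam_le (U w) delta) -> (forall x, F x -> exists w, U w x) ->
  coverable F delta #|W|.
Proof.
move=> dU FU.
(* The sets are numbered by the enumeration of [W]; [set0] is a dummy beyond its range. *)
exists (fun i => if insub i is Some j then U (enum_val (j : 'I_#|W|)) else set0).
split=> [i iW | x /FU [w Uwx]]; first by rewrite insubT; exact: dU.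
exists (enum_rank w) => //; by rewrite (valK (enum_rank w)) enum_rankK.
Qed.

Lemma covering_number_le F delta k :
  coverable F delta k -> covering_number F delta <= k%:R.
Proof.
move=> Fk; apply: ge_inf; last by exists k.
by exists 0 => _ [j _ <-]; exact: ler0n.
Qed.

(** Pigeonhole: a set of diameter at most [delta] holds at most one of the points. The cover of size
    [k] makes the set of counts nonempty, so that a lower bound passes to its [inf]. *)
Lemma covering_number_ge F delta k (W : finType) (x : W -> 'cV[R]_n) :
  coverable F delta k -> (forall w, F (x w)) ->
  (forall w w', w != w' -> delta < enorm (x w - x w')) ->
  #|W|%:R <= covering_number F delta.
Proof.
move=> Fk Fx sep; apply: lb_le_inf; first by exists k%:R, k.
move=> _ [j [U [dU FU]] <-]; rewrite ler_nat.
have /choice [f fP] : forall w, exists i : 'I_j, U i (x w).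
  by move=> w; have [i ij Uix] := FU _ (Fx w); exists (Ordinal ij).
rewrite -[j]card_ord; apply: (@leq_card _ _ f) => w w' ff.
apply/eqP; apply: contraT => /sep; rewrite ltNge => /negP; case.
by apply: (dU (f w)) => //; rewrite ff.
Qed.

End Coverings.

(** Both bounds apply with some [k] within bounded distance of [ln delta / ln c], so [ln (g delta)]
    is [ln N] times that ratio up to a constant, which division by [- ln delta] kills. *)
Lemma cvg_ln_ratio (R : realType) (g : R -> R) (c L : R) (N m : nat) :
  0 < c < 1 -> 1 <= L -> (0 < N)%N ->
  (forall delta k, 0 < delta -> L * c ^+ k <= delta -> g delta <= N%:R ^+ k) ->
  (forall delta k, 0 < delta -> delta < c ^+ (m + k) -> N%:R ^+ k <= g delta) ->
  ln (g delta) / - ln delta @[delta --> 0^'+] --> ln N%:R / - ln c.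
Proof.
move=> /andP[c0 c1] L1 N0 g_le g_ge.
pose l := - ln c; have l0 : 0 < l by rewrite oppr_gt0 ln_lt0 // c0 c1.
pose h : R := ln N%:R; have h0 : 0 <= h by rewrite ln_ge0 // ler1n.
have L0 : 0 < L by apply: lt_le_trans L1.
have lnL0 : 0 <= ln L by exact: ln_ge0.
(* The exponents used exceed [s / l] by at most [ln L / l + 1] or fall short by at most [m + 2],
   where [s = - ln delta]; [C] covers both. *)
pose C := (ln L / l + m%:R + 3) * h.
have C0 : 0 <= C.
  by rewrite mulr_ge0 // !addr_ge0 ?ler0n // divr_ge0 // ltW.
apply/cvgrPdist_le => eps eps0; near=> delta.
have d0 : 0 < delta by near: delta; exact: nbhs_right_gt.
pose s := - ln delta.
have dE : delta = expR (- s) by rewrite opprK lnK // posrE.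
have ltsP (r : R) : delta < expR (- r) -> r < s.
  by rewrite dE ltr_expR ltrN2.
have s_gt0 : 0 < s.
  by apply: ltsP; near: delta; apply: nbhs_right_lt; exact: expR_gt0.
(* This makes the natural subtraction of [m.+1] in the choice of [k2] exact. *)
have s_gtm : (m.+1)%:R * l < s.
  by apply: ltsP; near: delta; apply: nbhs_right_lt; exact: expR_gt0.
have s_gtC : C / eps < s.
  by apply: ltsP; near: delta; apply: nbhs_right_lt; exact: expR_gt0.
have powE (k : nat) : c ^+ k = expR (- (k%:R * l)).
  by rewrite mulrN opprK mulrC expRM_natr lnK // posrE.
have NpowE (k : nat) : N%:R ^+ k = expR (k%:R * h).
  by rewrite mulrC expRM_natr lnK // posrE ltr0n.
have [k1 [k1l k1g]] : exists k1 : nat, g delta <= N%:R ^+ k1 /\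
    k1%:R <= (s + ln L) / l + 1.
  exists (Num.truncn ((s + ln L) / l)).+1; split.
    apply: g_le => //; rewrite powE -{1}[L]lnK ?posrE // -expRD dE ler_expR.
    rewrite addrC -lerBrDr -opprD lerN2 -ler_pdivrMr //.
    exact/ltW/truncnS_gt.
  rewrite -addn1 natrD lerD2r.
  have q0 : 0 <= (s + ln L) / l by rewrite divr_ge0 ?addr_ge0 // ltW.
  by case/andP: (truncn_itv q0).
have [k2 [k2g k2l]] : exists k2 : nat, N%:R ^+ k2 <= g delta /\
    s / l - 1 - (m.+1)%:R <= k2%:R.
  have sl : (m.+1)%:R <= s / l by rewrite ler_pdivlMr // ltW.
  have /andP[t1 t2] : (Num.truncn (s / l))%:R <= s / l < (Num.truncn (s / l)).+1%:R.
    by apply: truncn_itv; exact: le_trans sl.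
  have mt : (m.+1 <= Num.truncn (s / l))%N.
    by rewrite -ltnS -(ltr_nat R); exact: le_lt_trans t2.
  (* Subtracting [m.+1] instead of [m] gives the strict inequality [delta < c^(m + k2)]. *)
  exists (Num.truncn (s / l) - m.+1)%N; split; last first.
    by rewrite natrB // lerD2r lerBlDr natr1 ltW.
  apply: g_ge => //; rewrite powE dE ltr_expR ltrN2 -ltr_pdivlMr //.
  apply: lt_le_trans t1; rewrite ltr_nat.
  by rewrite -[ltnRHS](subnKC mt) ltn_add2r.
have g0 : 0 < g delta.
  by apply: lt_le_trans k2g; rewrite NpowE expR_gt0.
have lng_le : ln (g delta) <= k1%:R * h.
  by rewrite -[leRHS]expRK ler_ln ?posrE ?expR_gt0 // -NpowE.
have lng_ge : k2%:R * h <= ln (g delta).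
  by rewrite -[leLHS]expRK ler_ln ?posrE ?expR_gt0 // -NpowE.
have m0 : 0 <= m%:R :> R := ler0n _ _.
have lt1 : ln (g delta) <= s * (h / l) + C.
  rewrite (_ : _ + C = ((s + ln L) / l + m%:R + 3) * h); last by rewrite /C; ring.
  apply: le_trans lng_le _; apply: ler_wpM2r => //; lra.
have lt2 : s * (h / l) - C <= ln (g delta).
  have lnLl : 0 <= ln L / l by rewrite divr_ge0 // ltW.
  rewrite (_ : _ - C = (s / l - ln L / l - m%:R - 3) * h); last by rewrite /C; ring.
  apply: le_trans lng_ge; apply: ler_wpM2r => //; rewrite -natr1 in k2l; lra.
rewrite -/l -/h -/s.
have -> : h / l - ln (g delta) / s = (s * (h / l) - ln (g delta)) / s.
  by rewrite mulrBl [s * _]mulrC mulfK // gt_eqF.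
rewrite normrM normfV (gtr0_norm s_gt0) ler_pdivrMr // (@le_trans _ _ C) //.
  by rewrite ler_norml; apply/andP; split; lra.
by rewrite -ler_pdivrMl // mulrC ltW.
Unshelve. all: by end_near. Qed.

(** * Box dimension of subsets of [T] containing a cylinder *)

Section BoxDimension.
Variables (R : realType) (n : nat) (A : 'M[int]_n) (c : R).
Hypothesis A_unit : intmxR R A \in unitmx.
Hypothesis c01 : 0 < c < 1.
Let B : 'M[R]_n := invmx (intmxR R A).
Hypothesis enormB : forall x : 'cV[R]_n, enorm (B *m x) = c * enorm x.
Variable Dc : set 'cV[int]_n.
Hypothesis Dc_residues : complete_residue_system A Dc.
Variable X : {fset 'cV[int]_n}.
Hypothesis XDc : [set` X] `<=` Dc.
Variable d0 : 'cV[int]_n.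
Hypothesis Xd0 : d0 \in X.

Let T : set 'cV[R]_n := TAE A [set` X].

(** A finite word padded with [d0], so that every term is an admissible digit; the first [k] terms
    ignore the padding. *)
Definition word_digits k (w : {ffun 'I_k -> X}) (j : nat) : 'cV[int]_n :=
  if insub j is Some i then val (w i) else d0.

Lemma word_digits_ord k (w : {ffun 'I_k -> X}) (i : 'I_k) :
  word_digits w i = val (w i).
Proof. by rewrite /word_digits valK. Qed.

Lemma word_digits_in k (w : {ffun 'I_k -> X}) j : word_digits w j \in X.
Proof. by rewrite /word_digits; case: insubP => // i _ _; exact: valP. Qed.

Lemma TAE_cylinders k x : T x -> exists (w : {ffun 'I_k -> X}) t,
  T t /\ x = digit_sum R A (word_digits w) k + B ^+ k *m t.
Proof.
move=> /(TAE_split A_unit c01 enormB k)[e [t [Ee Tt ->]]].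
exists [ffun i : 'I_k => [` Ee i]%fset], t; split=> //; congr (_ + _).
by apply: eq_bigr => j _; rewrite word_digits_ord ffunE.
Qed.

(** The upper bound covers all of [T]; the lower one counts points inside the given cylinder, whose
    prefix only shifts the exponent by [m]. *)
Lemma has_box_dim_cylinder (F : set 'cV[R]_n) p m :
  F `<=` T -> (forall t, T t -> F (digit_sum R A p m + B ^+ m *m t)) ->
  has_box_dim F (ln #|{: X}|%:R / - ln c).
Proof.
move=> FT TF; have /andP[c0 c1] := c01.
have [t0 Tt0] : T !=set0 by exact: (TAE_nonempty c01 enormB (E := [set` X]) Xd0).
have [L0 TL0] : exists L, forall x, T x -> l1norm x <= L.
  apply: (TAE_bounded c01 enormB (M := \sum_(d : X) enorm (intvR R (val d)))).
  move=> d Xd; rewrite (bigD1 [` Xd]%fset) //= lerDl.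
  by apply: sumr_ge0 => i _; exact: enorm_ge0.
have L0_ge0 : 0 <= L0 by apply: le_trans (TL0 _ Tt0); apply: sumr_ge0.
split; first by eexists; exact: TF Tt0.
split; first by exists L0 => x /FT /TL0; apply: le_trans; exact: enorm_le_l1norm.
(* A cylinder of length [k] has diameter at most [2 * L0 * c^k]; adding 1 makes the constant at
   least 1, as [cvg_ln_ratio] asks. *)
have cover delta k : (2 * L0 + 1) * c ^+ k <= delta -> coverable F delta (#|{: X}| ^ k)%N.
  move=> Lk; rewrite -[k in (_ ^ k)%N]card_ord -card_ffun.
  apply: (coverable_card (U := fun w => [set x | exists2 t, T t &
    x = digit_sum R A (word_digits w) k + B ^+ k *m t])); last first.
    by move=> x /FT /(TAE_cylinders k) [w [t [Tt ->]]]; exists w, t.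
  move=> w _ _ [t Tt ->] [t' Tt' ->]; rewrite opprD addrACA subrr add0r.
  rewrite -mulmxBr (enorm_expB enormB); apply: le_trans Lk.
  rewrite mulrC ler_wpM2r ?(exprn_ge0 _ (ltW c0)) //.
  rewrite (le_trans (enorm_le_l1norm _)) //.
  rewrite (le_trans (ler_l1normD _ _)) // l1normN.
  by have := TL0 _ Tt; have := TL0 _ Tt'; lra.
have c_small delta : 0 < delta -> exists k, (2 * L0 + 1) * c ^+ k <= delta.
  move=> delta0; have cc : `|c| < 1 by rewrite ger0_norm // ltW.
  have /cvgrPdist_le/(_ _ delta0) [k _ /(_ k (leqnn k))] :=
    cvg_geometric (2 * L0 + 1) cc.
  rewrite sub0r normrN => /(le_trans (ler_norm _)) ?.
  by exists k.
apply: (cvg_ln_ratio (L := 2 * L0 + 1) (m := m)) => //.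
- by lra.
- by apply/card_gt0P; exists [` Xd0]%fset.
- by move=> delta k _ /cover /covering_number_le; rewrite natrX.
move=> delta k delta0 deltac.
have [k' /cover Fk'] := c_small _ delta0.
rewrite -natrX -[k in (_ ^ k)%N]card_ord -card_ffun.
(* One test point per word of length [k]; the common prefix and tail [t0] cancel in differences,
   leaving [B^m] times a difference of partial sums. *)
apply: (covering_number_ge (x := fun w : {ffun 'I_k -> X} => digit_sum R A p m +
  B ^+ m *m (digit_sum R A (word_digits w) k + B ^+ k *m t0)) Fk').
  move=> w; apply: TF; apply: (TAE_cat enormB) => // j.
  exact: word_digits_in.
move=> w w' ww'; rewrite opprD addrACA subrr add0r -mulmxBr.
rewrite opprD addrACA subrr addr0 (enorm_expB enormB).
apply: lt_le_trans deltac _; rewrite exprD ler_wpM2l ?(exprn_ge0 _ (ltW c0)) //.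
apply: (enorm_digit_sum_sep A_unit c01 enormB Dc_residues).
- by move=> j; apply: XDc; exact: word_digits_in.
- by move=> j; apply: XDc; exact: word_digits_in.
have [i wi] : exists i, w i != w' i.
  apply/existsP; apply: contraNT ww'; rewrite negb_exists => /forallP ww'.
  by apply/eqP/ffunP => i; apply/eqP; have := ww' i; rewrite negbK.
by exists i => //; rewrite !word_digits_ord => /val_inj/eqP; exact/negP.
Qed.

End BoxDimension.

(** * Density of the truncated expansions *)

Unset Implicit Arguments.

Theorem mainTheorem15 (R : realType) (n : nat) (A : 'M[int]_n)
  (Dc D : set 'cV[int]_n) :
  intmxR R A \in unitmx ->
  inv_is_similarity R A ->
  complete_residue_system A Dc ->
  D `<=` Dc ->
  dense_in
    [set alpha | @TAE R n A (diffset D) alpha /\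
       exists d : R, has_box_dim (@TAE R n A D) d /\
         has_box_dim (@TAE R n A D `&` translate (@TAE R n A D) alpha) d]
    (@TAE R n A (diffset D)).
Proof.
move=> A_unit [c [c01 simc]] Dc_res DDc.
have enormB (x : 'cV[R]_n) : enorm (invmx (intmxR R A) *m x) = c * enorm x.
  by have := simc x 0; rewrite mulmx0 !subr0.
have /finite_fsetP [X DX] : finite_set D.
  exact: sub_finite_set (residue_system_finite A_unit Dc_res).
split=> [alpha [] //|a [e [De /cvg_enormP ea]] eps eps0].
have [d Dd] : D !=set0 by have [d Dd _] := De 0%N; exists d.
rewrite DX in DDc Dd De *.
have boxdim F p m := @has_box_dim_cylinder _ _ _ _ A_unit c01 enormB _ Dc_res
  _ DDc _ Dd F p m.
have /choice [pq pqP] : forall j, exists pq, [/\ pq.1 \in X, pq.2 \in X & pq.1 - pq.2 = e j].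
  by move=> j; have [p Xp [q Xq pqe]] := De j; exists (p, q).
have /cvgrPdist_lt/(_ _ eps0) [m _ /(_ m (leqnn m))] := ea.
rewrite /= sub0r normrN ger0_norm ?enorm_ge0 // -/(digit_sum _ _ _ _) => am.
exists (digit_sum R A e m); last by rewrite enormBC.
split.
  (* The truncation continues with zero digits, and [0 = d - d] is a difference of digits. *)
  rewrite -[digit_sum _ _ _ _]addr0 -(mulmx0 _ (invmx (intmxR R A) ^+ m)).
  apply: (TAE_cat enormB) => //; apply: TAE_0.
  by exists d => //; exists d => //; rewrite subrr.
exists (ln #|{: X}|%:R / - ln c); split.
  (* The set [T] is its own cylinder for the empty word. *)
  apply: (boxdim _ (fun=> 0) 0%N) => // t Tt.
  by rewrite digit_sum0 expr0 mul1mx add0r.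
apply: (boxdim _ (fun j => (pq j).1) m) => [x []//|t Tt]; split.
  by apply: (TAE_cat enormB) => // j; have [] := pqP j.
(* Keep the tail [t] and replace each [p_j] by [q_j]; adding [alpha], with digits [p_j - q_j],
   restores the prefix. *)
exists (digit_sum R A (fun j => (pq j).2) m + invmx (intmxR R A) ^+ m *m t).
  by apply: (TAE_cat enormB) => // j; have [] := pqP j.
rewrite addrAC; congr (_ + _); rewrite -big_split; apply: eq_bigr => j _ /=.
rewrite -mulmxDr; congr (_ *m _); have [_ _ <-] := pqP j.
by rewrite /intvR -map_mxD addrC subrK.
Qed.
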